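(* The set consisting of the two quasi-identities $$x\preccurlyeq\neg x,\ \neg(x\vee y)\preccurlyeq x\vee y,\ \neg y\vee z\approx\top\ \Rightarrow\ z\approx\top$$ and $$x\preccurlyeq\neg x,\ y\preccurlyeq\neg y,\ x\wedge y\approx\bot\ \Rightarrow\ x\vee y\preccurlyeq\neg(x\vee y)$$ is a basis for the admissible quasi-identities of De Morgan algebras.
   Context: A De Morgan algebra is an algebra $(A,\wedge,\vee,\neg,\bot,\top)$ such that $(A,\wedge,\vee,\bot,\top)$ is a bounded distributive lattice, $\neg\neg a=a$ and $\neg(a\wedge b)=\neg a\vee\neg b$ for all $a,b\in A$. $\varphi\preccurlyeq\psi$ abbreviates the identity $\varphi\wedge\psi\approx\varphi$. A quasi-identity (finitely many premise identities and one conclusion identity) is satisfied by an algebra if every assignment making all its premises true makes its conclusion true. A quasivariety is the class of all algebras of the language satisfying some set of quasi-identities; $\mathbb{Q}(\mathcal{K})$ is the smallest quasivariety containing $\mathcal{K}$. For a quasivariety $\mathcal{Q}$, $\mathbf{F}_{\mathcal{Q}}$ is its free algebra on countably infinitely many generators. A set $\Lambda$ of quasi-identities is a basis for the admissible quasi-identities of $\mathcal{Q}$ if $\mathbb{Q}(\mathbf{F}_{\mathcal{Q}})$ is axiomatized by $\Lambda$ relative to $\mathcal{Q}$, i.e. for every algebra $\mathbf{A}$: $\mathbf{A}\in\mathbb{Q}(\mathbf{F}_{\mathcal{Q}})$ iff $\mathbf{A}\in\mathcal{Q}$ and $\mathbf{A}$ satisfies all members of $\Lambda$. *)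

(* Defs.v *)
From HB Require Import structures.
From mathcomp Require Import ssreflect ssrfun ssrbool eqtype ssrnat seq choice.
From mathcomp Require Import generic_quotient boolp classical_sets.

Set Implicit Arguments.
Unset Strict Implicit.
Unset Printing Implicit Defensive.

Local Open Scope classical_set_scope.
Local Open Scope quotient_scope.

(* An arbitrary algebra of the language (meet, join, neg, bot, top); no
   equation is assumed. *)
Record algebra := Algebra {
  carrier :> Type;
  meet : carrier -> carrier -> carrier;
  join : carrier -> carrier -> carrier;
  neg : carrier -> carrier;
  bot : carrier;
  top : carrier
}.
Arguments bot {a}.
Arguments top {a}.

Definition is_hom (A B : algebra) (h : A -> B) : Prop :=
  [/\ {morph h : x y / meet x y >-> meet x y},
      {morph h : x y / join x y >-> join x y},
      {morph h : x / neg x >-> neg x},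
      h bot = bot & h top = top].

(* Written out on raw algebras, since MathComp's lattice structures carry their
   own order and choice operator and cannot be predicated of an algebra. *)
Definition de_morgan (A : algebra) : Prop :=
  [/\ [/\ associative (@meet A), commutative (@meet A)
        & forall a b : A, meet a (join a b) = a],
      [/\ associative (@join A), commutative (@join A)
        & forall a b : A, join a (meet a b) = a],
      left_distributive (@meet A) (@join A),
      (forall a : A, join bot a = a) /\ (forall a : A, meet a top = a)
    & involutive (@neg A) /\
      (forall a b : A, neg (meet a b) = join (neg a) (neg b))].

Inductive term :=
  | Var of nat
  | Meet of term & term
  | Join of term & term
  | Neg of term
  | Bot
  | Top.

HB.instance Definition _ := gen_eqMixin term.
HB.instance Definition _ := gen_choiceMixin term.

Fixpoint eval (A : algebra) (v : nat -> A) (t : term) : A :=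
  match t with
  | Var n => v n
  | Meet t1 t2 => meet (eval v t1) (eval v t2)
  | Join t1 t2 => join (eval v t1) (eval v t2)
  | Neg t1 => neg (eval v t1)
  | Bot => bot
  | Top => top
  end.

Definition identity : Type := term * term.

Record quasi_identity := QuasiIdentity {
  premises : seq identity;
  conclusion : identity
}.

Declare Scope dm_scope.
Delimit Scope dm_scope with dm.
Bind Scope dm_scope with term.
Notation "⊥" := Bot : dm_scope.
Notation "⊤" := Top : dm_scope.
Notation "¬ s" := (Neg s) (at level 35, right associativity) : dm_scope.
Notation "s ⊓ t" := (Meet s t) (at level 40, left associativity) : dm_scope.
Notation "s ⊔ t" := (Join s t) (at level 50, left associativity) : dm_scope.
Notation "s ≈ t" := ((s, t) : identity) (at level 70) : dm_scope.
Notation "s ≼ t" := (s ⊓ t ≈ s)%dm (at level 70) : dm_scope.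
Notation "ps ⇒ c" := (QuasiIdentity ps c) (at level 90) : dm_scope.

Definition holds (A : algebra) (v : nat -> A) (e : identity) : Prop :=
  eval v e.1 = eval v e.2.

Definition satisfies (A : algebra) (q : quasi_identity) : Prop :=
  forall v : nat -> A,
    (forall e, e \in premises q -> holds v e) -> holds v (conclusion q).

Definition satisfies_all (A : algebra) (L : set quasi_identity) : Prop :=
  forall q, L q -> satisfies A q.

(* Classes of algebras are plain predicates: [set algebra] is a universe
   inconsistency, as carriers must include quotients of [choiceType]s. *)
Definition is_quasivariety (K : algebra -> Prop) : Prop :=
  exists L : set quasi_identity, forall A, K A <-> satisfies_all A L.

Definition generated_quasivariety (K : algebra -> Prop) (A : algebra) : Prop :=
  forall Q, is_quasivariety Q -> (forall B, K B -> Q B) -> Q A.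

Section FreeAlgebra.
Variable Q : algebra -> Prop.

Definition valid (s t : term) : Prop :=
  forall A, Q A -> forall v : nat -> A, eval v s = eval v t.

Definition validb : rel term := fun s t => `[< valid s t >].

Lemma validb_refl : reflexive validb.
Proof. by move=> s; apply/asboolP. Qed.

Lemma validb_sym : symmetric validb.
Proof.
by move=> s t; apply/asboolP/asboolP => st A QA v; rewrite (st A QA v).
Qed.

Lemma validb_trans : transitive validb.
Proof.
move=> t s u /asboolP st /asboolP tu; apply/asboolP => A QA v.
by rewrite st // tu.
Qed.

Canonical valid_equiv := EquivRel validb validb_refl validb_sym validb_trans.

Definition free_carrier : Type := {eq_quot valid_equiv}.

Definition term_class (t : term) : free_carrier := \pi_({eq_quot valid_equiv}) t.

Definition class_repr (x : free_carrier) : term :=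
  repr (x : {eq_quot valid_equiv}).

(* The term algebra modulo the identities valid in [Q]; the operations do not
   depend on the representatives, see [term_class_hom]. *)
Definition free_algebra : algebra := {|
  carrier := free_carrier;
  meet x y := term_class (Meet (class_repr x) (class_repr y));
  join x y := term_class (Join (class_repr x) (class_repr y));
  neg x := term_class (Neg (class_repr x));
  bot := term_class Bot;
  top := term_class Top |}.

Definition free_generator (n : nat) : free_algebra := term_class (Var n).

Lemma term_classP s t : term_class s = term_class t <-> valid s t.
Proof.
split=> [/eqmodP/asboolP //|st]; apply/eqmodP.
by rewrite /=; apply/asboolP.
Qed.

Lemma class_reprK x : term_class (class_repr x) = x.
Proof. exact: reprK. Qed.

Lemma class_repr_valid t : valid (class_repr (term_class t)) t.
Proof. by apply/term_classP; rewrite class_reprK. Qed.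

Definition term_algebra : algebra := Algebra Meet Join Neg Bot Top.

Lemma term_class_hom : @is_hom term_algebra free_algebra term_class.
Proof.
split=> //= [s t|s t|s]; apply/term_classP => A QA v /=;
  by rewrite !class_repr_valid.
Qed.

Lemma eval_term (A : algebra) (v : nat -> A) (s : nat -> term) t :
  eval v (@eval term_algebra s t) = eval (fun n => eval v (s n)) t.
Proof. by elim: t => //= [t -> u ->|t -> u ->|t ->]. Qed.

Lemma eval_hom (A B : algebra) (h : A -> B) (v : nat -> A) t :
  is_hom h -> h (eval v t) = eval (h \o v) t.
Proof.
case=> hM hJ hN h0 h1.
by elim: t => //= [t <- u <-|t <- u <-|t <-]; rewrite ?hM ?hJ ?hN.
Qed.

Lemma free_algebra_in : is_quasivariety Q -> Q free_algebra.
Proof.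
case=> L QL; apply/QL => q Lq v prem.
have evalE t :
    eval v t = term_class (@eval term_algebra (class_repr \o v) t).
  rewrite (eval_hom _ _ term_class_hom); congr eval.
  by apply: funext => n /=; rewrite class_reprK.
rewrite /holds !evalE; apply/term_classP => A QA w.
rewrite !eval_term; apply: (iffLR (QL A) QA q Lq) => e /prem.
by rewrite /holds !evalE => /term_classP/(_ A QA w); rewrite !eval_term.
Qed.

Lemma free_algebra_universal (A : algebra) (v : nat -> A) : Q A ->
  exists! h : free_algebra -> A, is_hom h /\ forall n, h (free_generator n) = v n.
Proof.
move=> QA; exists (fun x => eval v (class_repr x)); split.
  have E t : eval v (class_repr (term_class t)) = eval v t.
    exact: class_repr_valid.
  by split=> [|n]; [split=> [x y|x y|x||] |]; rewrite E.
move=> h [hom_h hv]; apply: funext => x.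
have E t : h (term_class t) = eval v t.
  elim: t => [n|t IHt u IHu|t IHt u IHu|t IHt||] /=; first exact: hv.
  - by case: hom_h term_class_hom => hM _ _ _ _ [-> _ _ _ _]; rewrite hM IHt IHu.
  - by case: hom_h term_class_hom => _ hJ _ _ _ [_ -> _ _ _]; rewrite hJ IHt IHu.
  - by case: hom_h term_class_hom => _ _ hN _ _ [_ _ -> _ _]; rewrite hN IHt.
  - by case: hom_h.
  - by case: hom_h.
by rewrite -E class_reprK.
Qed.

End FreeAlgebra.

Definition admissible_basis (Q : algebra -> Prop) (L : set quasi_identity) : Prop :=
  forall A : algebra,
    generated_quasivariety (fun B => B = free_algebra Q) A <->
    Q A /\ satisfies_all A L.

Lemma de_morgan_quasivariety : is_quasivariety de_morgan.
Proof.
pose x := Var 0; pose y := Var 1; pose z := Var 2.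
pose ax (s t : term) : quasi_identity := QuasiIdentity [::] (s, t).
have axP A s t : satisfies A (ax s t) <-> forall v : nat -> A, eval v s = eval v t.
  by split=> [H v|H v _]; [apply: H | exact: H].
pose L : seq (term * term) :=
  [:: (x ⊓ (y ⊓ z), x ⊓ y ⊓ z); (x ⊓ y, y ⊓ x); (x ⊓ (x ⊔ y), x);
      (x ⊔ (y ⊔ z), x ⊔ y ⊔ z); (x ⊔ y, y ⊔ x); (x ⊔ (x ⊓ y), x);
      ((x ⊔ y) ⊓ z, x ⊓ z ⊔ y ⊓ z); (⊥ ⊔ x, x); (x ⊓ ⊤, x);
      (¬ ¬ x, x); (¬ (x ⊓ y), ¬ x ⊔ ¬ y)]%dm.
exists [set q | exists2 e, e \in L & q = ax e.1 e.2] => A; split.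
  case=> -[mA mC mJ] [jA jC jM] D [b0 t1] [nK nM] q [e eL ->].
  apply/axP => v; move: eL; rewrite !inE.
  by do 10![case/orP => [/eqP->|] /=; first by auto]; move=> /eqP-> /=.
move=> H.
have E s t (a b c : A) : (s, t) \in L ->
    eval (nth a [:: a; b; c]) s = eval (nth a [:: a; b; c]) t.
  by move=> eL; apply: (iffLR (axP A s t)); apply: H; exists (s, t).
split; first split=> [a b c|a b|a b].
- by apply: (E (x ⊓ (y ⊓ z)) (x ⊓ y ⊓ z) a b c)%dm; rewrite !inE eqxx ?orbT.
- by apply: (E (x ⊓ y) (y ⊓ x) a b a)%dm; rewrite !inE eqxx ?orbT.
- by apply: (E (x ⊓ (x ⊔ y)) x a b a)%dm; rewrite !inE eqxx ?orbT.
- split=> [a b c|a b|a b].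
  + by apply: (E (x ⊔ (y ⊔ z)) (x ⊔ y ⊔ z) a b c)%dm; rewrite !inE eqxx ?orbT.
  + by apply: (E (x ⊔ y) (y ⊔ x) a b a)%dm; rewrite !inE eqxx ?orbT.
  + by apply: (E (x ⊔ (x ⊓ y)) x a b a)%dm; rewrite !inE eqxx ?orbT.
- move=> a b c.
  by apply: (E ((x ⊔ y) ⊓ z) (x ⊓ z ⊔ y ⊓ z) a b c)%dm; rewrite !inE eqxx ?orbT.
- split=> a.
  + by apply: (E (⊥ ⊔ x) x a a a)%dm; rewrite !inE eqxx ?orbT.
  + by apply: (E (x ⊓ ⊤) x a a a)%dm; rewrite !inE eqxx ?orbT.
- split=> [a|a b].
  + by apply: (E (¬ ¬ x) x a a a)%dm; rewrite !inE eqxx ?orbT.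
  + by apply: (E (¬ (x ⊓ y)) (¬ x ⊔ ¬ y) a b a)%dm; rewrite !inE eqxx ?orbT.
Qed.

(* Main.v *)
(* Represent a prime filter of a De Morgan algebra A by its characteristic
   function p; then [dual p] is prime as well, and this is an antitone involution.
   Top is join-prime and bottom meet-prime in the free algebra F, which yields both
   quasi-identities there.  Conversely, the quasi-identities say about A:
   - the second: any p and its dual lie in a common prime, hence in a maximal w;
   - the first: every maximal w contains a prime c with [dual c = c].
   The five primes [dual w], c, p, [dual p], w are the image of the dual space of
   the free algebra on two generators under a map commuting with [dual].  This map
   induces a homomorphism A -> F that separates whatever p separates, so A embeds
   into a power of F.  Zorn's lemma provides the primes, and A need not be finite. *)
Require Import Defs.
From mathcomp Require Import ssreflect ssrfun ssrbool eqtype ssrnat seq.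
From mathcomp Require Import boolp classical_sets.

Local Open Scope classical_set_scope.
Local Open Scope dm_scope.

Set Implicit Arguments.
Unset Strict Implicit.
Unset Printing Implicit Defensive.

Ltac bool_cases p :=
  repeat match goal with |- context [p ?x] => case: (p x) => //= end; by [].

(** * Filters, ideals and prime separation *)

Definition le (A : algebra) (a b : A) : Prop := meet a b = a.

Definition is_filter (A : algebra) (F : set A) : Prop :=
  [/\ F top, forall a b, F a -> F b -> F (meet a b)
    & forall a b, le a b -> F a -> F b].

Definition is_ideal (A : algebra) (I : set A) : Prop :=
  [/\ I bot, forall a b, I a -> I b -> I (join a b)
    & forall a b, le a b -> I b -> I a].

Definition is_prime (A : algebra) (p : A -> bool) : Prop :=
  [/\ {morph p : a b / meet a b >-> a && b},
      {morph p : a b / join a b >-> a || b}, p bot = false & p top = true].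

Definition dual (A : algebra) (p : A -> bool) (a : A) : bool := ~~ p (neg a).

Section DeMorgan.
Variables (A : algebra) (dmA : de_morgan A).
Implicit Types (a b c : A) (p : A -> bool) (F I : set A).

Let mA : associative (@meet A). Proof. by case: dmA => -[]. Qed.
Let mC : commutative (@meet A). Proof. by case: dmA => -[]. Qed.
Let mJ a b : meet a (join a b) = a. Proof. by case: dmA => -[]. Qed.
Let jC : commutative (@join A). Proof. by case: dmA => _ []. Qed.
Let jM a b : join a (meet a b) = a. Proof. by case: dmA => _ []. Qed.
Let mDl : left_distributive (@meet A) (@join A). Proof. by case: dmA. Qed.
Let jb a : join bot a = a. Proof. by case: dmA => _ _ _ []. Qed.
Let mt a : meet a top = a. Proof. by case: dmA => _ _ _ []. Qed.
Let nn : involutive (@neg A). Proof. by case: dmA => _ _ _ _ []. Qed.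
Let nM a b : neg (meet a b) = join (neg a) (neg b).
Proof. by case: dmA => _ _ _ _ []. Qed.
Let mm a : meet a a = a. Proof. by rewrite -{2}(jM a a) mJ. Qed.

Lemma neg_join a b : neg (join a b) = meet (neg a) (neg b).
Proof. by rewrite -{1}(nn a) -{1}(nn b) -nM nn. Qed.

Lemma neg_bot : neg bot = top :> A.
Proof.
have H b : join (neg bot) b = neg bot.
  by rewrite -{1}(nn b) -nM -(jb (neg b)) mJ.
by rewrite -(H top) jC -(mt (neg bot)) mC jM.
Qed.

Lemma neg_top : neg top = bot :> A.
Proof. by rewrite -neg_bot nn. Qed.

Let le_refl a : le a a. Proof. exact: mm. Qed.
Let le_top a : le a top. Proof. exact: mt. Qed.
Let le_trans b a c : le a b -> le b c -> le a c.
Proof. by rewrite /le => ab bc; rewrite -ab -mA bc. Qed.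
Let le_meet a b c : le a b -> le a c -> le a (meet b c).
Proof. by rewrite /le mA => -> ->. Qed.
Let le_meetl a b : le (meet a b) a.
Proof. by rewrite /le mC mA mm. Qed.
Let le_meetr a b : le (meet a b) b.
Proof. by rewrite /le -mA mm. Qed.
Let le_bot a : le bot a.
Proof. by rewrite /le -{1}(jb a) mJ. Qed.
Let bot_le a : le a bot -> a = bot.
Proof. by rewrite /le => <-; rewrite mC -{1}(jb a) mJ. Qed.
Let le_joinl a b : le a (join a b). Proof. exact: mJ. Qed.
Let le_joinr a b : le b (join a b). Proof. by rewrite jC. Qed.
Let join_le a b c : le a c -> le b c -> le (join a b) c.
Proof. by rewrite /le mDl => -> ->. Qed.

#[local] Hint Resolve le_refl le_top le_bot le_meetl le_meetr le_joinl le_joinr : core.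

(** Zorn gives a maximal filter that contains [F] and misses [I]. Adjoining any further [a] makes it
    meet [I], which is the last clause; primeness follows from that clause by distributivity. *)
Lemma prime_filter_maximal F I :
  is_filter F -> is_ideal I -> (forall a, F a -> ~ I a) ->
  exists p, [/\ is_prime p, forall a, F a -> p a, forall a, I a -> ~~ p a
    & forall a, ~~ p a -> exists2 b, p b & I (meet a b)].
Proof.
move=> [Ft FM Fle] [Ib IJ Ile] FI.
pose P (G : set A) := G = set0 \/
  [/\ is_filter G, F `<=` G & forall a, G a -> ~ I a].
have PF : P F by right; split.
have [C CP totC|M [PM maxM]] := @Zorn_bigcup A P.
  have [C0|/existsNP[G /not_implyP[CG nG0]]] := pselect (forall G, C G -> G = set0).
    by left; apply/seteqP; split=> // a [G /C0->].
  right; case: (CP _ CG) => // -[[Gt GM Gle] FG GI].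
  split=> [|a Fa|a [H CH Ha]]; last 2 first.
  - by exists G => //; exact: FG.
  - by case: (CP _ CH) => [H0|[_ _]]; [rewrite H0 in Ha | apply].
  split=> [|a b [H CH Ha] [K CK Kb]|a b ab [H CH Ha]].
  - by exists G.
  - wlog HK : a b H K CH CK Ha Kb / H `<=` K => [WL|].
      case: (totC _ _ CH CK) => HK; first exact: WL HK.
      by rewrite mC; apply: WL HK.
    exists K => //; case: (CP _ CK) => [K0|[[_ KM _] _ _]].
      by rewrite K0 in Kb.
    by apply: KM => //; exact: HK.
  - exists H => //; case: (CP _ CH) => [H0|[[_ _ Hle] _ _]].
      by rewrite H0 in Ha.
    exact: Hle Ha.
have {PM} [[Mt MM Mle] FM' MI] : [/\ is_filter M, F `<=` M & forall a, M a -> ~ I a].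
  case: PM => // M0; case: (maxM F) => //; rewrite M0; split=> //.
  by move=> /(_ top Ft).
have MI' a : ~ M a -> exists2 b, M b & I (meet a b).
  move=> Ma; apply: contrapT => nex.
  (* [N] is the filter generated by [M] and [a]. *)
  pose N := [set c | exists2 m, M m & le (meet a m) c].
  case: (maxM N).
    split=> [m Mm|/(_ a) NM]; first by exists m.
    by apply: Ma; apply: NM; exists top.
  right; split=> [|c Fc|c [m Mm amc] Ic].
  - split=> [|c d [m Mm mc] [n Mn nd]|c d cd [m Mm mc]].
    + by exists top.
    + exists (meet m n); first exact: MM.
      apply: le_meet.
        apply: le_trans mc; apply: le_meet => //.
        exact: le_trans (le_meetr _ _) (le_meetl _ _).
      by apply: le_trans nd; apply: le_meet; rewrite // mA.
    + by exists m => //; exact: le_trans cd.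
  - by exists c => //; exact: FM'.
  - by apply: nex; exists m => //; exact: Ile Ic.
exists (fun a => `[< M a >]); split.
- split.
  + move=> a b; apply/asboolP/andP => [Mab|[/asboolP Ma /asboolP Mb]].
      by split; apply/asboolP; apply: Mle Mab.
    exact: MM.
  + move=> a b; apply/asboolP/orP => [Mab|].
      have [Ma|Ma] := pselect (M a); first by left; apply/asboolP.
      right; apply/asboolP; apply: contrapT => Mb.
      have [[c Mc Iac] [d Md Ibd]] := (MI' a Ma, MI' b Mb).
      apply: (MI (meet (join a b) (meet c d))); first exact: MM Mab (MM _ _ Mc Md).
      apply: Ile (IJ _ _ Iac Ibd); rewrite mDl; apply: join_le.
        by apply: le_trans (le_joinl _ _); rewrite mA.
      by apply: le_trans (le_joinr _ _); rewrite (mC c) mA.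
    by case=> /asboolP Mc; apply: Mle Mc.
  + by apply/asboolPn => /MI.
  + exact/asboolP.
- by move=> a Fa; apply/asboolP/FM'.
- by move=> a Ia; apply/asboolPn => /MI.
- by move=> a /asboolPn /MI'[b Mb Iab]; exists b => //; apply/asboolP.
Qed.

(** For the converse, a prime separates the filter above [a] from the ideal below [b]. Lattice
    inequalities thus become boolean tables, closed by [bool_cases]. *)
Lemma le_primeP a b : le a b <-> (forall p, is_prime p -> p a -> p b).
Proof.
split=> [ab p [pM _ _ _]|H]; first by rewrite -{1}ab pM => /andP[].
apply: contrapT => nab.
have [|||p [pP pF pI _]] := @prime_filter_maximal [set c | le a c] [set c | le c b].
- by split=> //= [c d|c d cd ac]; [exact: le_meet | exact: le_trans cd].
- by split=> //= [c d|c d cd db]; [exact: join_le | exact: le_trans db].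
- by move=> c ac cb; apply: nab; exact: le_trans cb.
by move: (H p pP (pF _ (le_refl a))); rewrite (negbTE (pI _ (le_refl b))).
Qed.

Lemma eq_primeP a b : a = b <-> (forall p, is_prime p -> p a = p b).
Proof.
split=> [-> //|H].
have ab : le a b by apply/le_primeP => p /H->.
have ba : le b a by apply/le_primeP => p /H->.
by rewrite -ab mC.
Qed.

Lemma prime_le p a b : is_prime p -> le a b -> p a ==> p b.
Proof. by move=> pP ab; apply/implyP; apply: (iffLR (le_primeP a b)). Qed.

Lemma dual_prime p : is_prime p -> is_prime (dual p).
Proof.
case=> pM pJ pb pt; rewrite /dual; split=> [a b|a b||].
- by rewrite nM pJ negb_or.
- by rewrite neg_join pM negb_and.
- by rewrite neg_bot pt.
- by rewrite neg_top pb.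
Qed.

Lemma dual_neg p a : dual p (neg a) = ~~ p a.
Proof. by rewrite /dual nn. Qed.

Lemma join_top a : join top a = top.
Proof. by rewrite -{2}(jM top a) (mC top) mt. Qed.

Lemma meet_bot a : meet bot a = bot.
Proof. exact: le_bot. Qed.

(** * The two quasi-identities and the primes they provide *)

Definition weakly_connected : Prop := forall a b,
  le a (neg a) -> le b (neg b) -> meet a b = bot -> le (join a b) (neg (join a b)).

Definition fixpoint_dense : Prop := forall a b c,
  le a (neg a) -> le (neg (join a b)) (join a b) -> join (neg b) c = top -> c = top.

(** The filter generated by [p] and [dual p] is proper by weak connectedness; extend it to a filter
    maximal among those missing [bot]. *)
Lemma maximal_above_dual p : weakly_connected -> is_prime p ->
  exists w, [/\ is_prime w, forall a, p a -> w a, forall a, dual p a -> w a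
    & forall a, ~~ w a -> exists2 b, w b & meet a b = bot].
Proof.
move=> conA pP; have qP := dual_prime pP; have [pM pJ pb pt] := pP.
pose F := [set c : A | exists a b, [/\ p a, dual p b & le (meet a b) c]].
have pq a b : p a -> dual p b -> meet a b <> bot.
  move=> pa qb ab0.
  have [pq|/existsNP[c /not_implyP[pc /negP qc]]] := pselect (forall c, p c -> dual p c).
    have : dual p (meet a b) by case: qP => -> *; rewrite pq.
    by rewrite ab0; case: qP => _ _ ->.
  have [qp|/existsNP[d /not_implyP[qd /negP pd]]] := pselect (forall c, dual p c -> p c).
    have : p (meet a b) by rewrite pM pa qp.
    by rewrite ab0 pb.
  (* Here [c ∧ ¬c] is in [p] and [d ∧ ¬d] in [dual p]. Meeting them with [a] and [b] gives disjoint
     elements below their negations. Their join would be in both primes, yet below its own negation,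
     so not in [dual p]. *)
  have lem (x y : A) : le (meet x (meet y (neg y))) (neg (meet x (meet y (neg y)))).
    apply/le_primeP => r [rM rJ _ _]; rewrite !(nM, nn, rM, rJ).
    bool_cases r.
  have := conA _ _ (lem a c) (lem b d).
  have -> : meet (meet a (meet c (neg c))) (meet b (meet d (neg d))) = bot.
    apply/eq_primeP => r [rM _ rb _]; have := rM a b; rewrite ab0 rb !rM.
    bool_cases r.
  move=> /(_ erefl) /(prime_le pP); move: pa qb pc qc pd qd.
  rewrite /dual !(nM, neg_join, nn, pM, pJ).
  bool_cases p.
have FF : is_filter F.
  split=> [|c d [a1 [b1 [pa1 qb1 le1]]] [a2 [b2 [pa2 qb2 le2]]]|c d cd [a [b [pa qb abc]]]].
  - by exists top, top; split=> //; case: qP.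
  - exists (meet a1 a2), (meet b1 b2); split; first by rewrite pM pa1.
      by case: qP => -> *; rewrite qb1.
    apply/le_primeP => r rP; move: (prime_le rP le1) (prime_le rP le2).
    by case: rP => rM _ _ _; rewrite !rM; bool_cases r.
  - by exists a, b; split=> //; exact: le_trans cd.
have [||w [wP Fw _ wmax]] := @prime_filter_maximal F [set bot] FF.
- split=> //= [a b -> ->|a b ab b0]; first exact: jb.
  by apply: bot_le; rewrite -b0.
- by move=> c [a [b [pa qb abc]]] c0; apply: (pq a b) => //; apply: bot_le; rewrite -c0.
exists w; split=> // a Ha; apply: Fw.
  by exists a, top; split=> //; case: qP.
by exists top, a; split.
Qed.

(** A prime containing [E] and missing [I] is self-dual, as [a ∨ ¬a] is in [E] and its negation in
    [I]; it lies inside [w], whose complement is in [I]. Fixpoint density makes [E] and [I]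
    disjoint. *)
Lemma fixpoint_below_maximal w : fixpoint_dense -> is_prime w ->
    (forall a, ~~ w a -> exists2 b, w b & meet a b = bot) ->
  exists c : A -> bool, [/\ is_prime c, dual c = c & forall a, c a -> w a].
Proof.
move=> fixA wP wmax; have [wM wJ wb wt] := wP.
pose E := [set e : A | exists2 x, le x (neg x) & le (neg x) (join x e)].
pose I := [set b : A | exists i e, [/\ ~~ w i, E e & le b (join i (neg e))]].
(* [E] is the filter of elements lying in every self-dual prime. *)
have EF : is_filter E.
  split=> [|e1 e2 [x1 x1n le1] [x2 x2n le2]|d e de [x xn xe]].
  - by exists bot; [exact: le_bot | rewrite neg_bot].
  (* The plain join of [x1] and [x2] may fail to lie below its negation; cutting [x2] by [neg x1]
     repairs this. *)
  - exists (join x1 (meet x2 (neg x1))); apply/le_primeP => p pP;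
      have qP := dual_prime pP;
      move: (prime_le pP x1n) (prime_le pP x2n) (prime_le pP le1) (prime_le pP le2);
      move: (prime_le qP x1n) (prime_le qP x2n) (prime_le qP le1) (prime_le qP le2);
      case: pP => pM pJ _ _; rewrite /dual !(nM, neg_join, nn, pM, pJ);
      bool_cases p.
  - by exists x => //; apply: le_trans xe _; apply: join_le => //; exact: le_trans de _.
have EM a b : E a -> E b -> E (meet a b) by case: EF => _ + _; apply.
have Eex a : E (join a (neg a)).
  exists (meet a (neg a)); apply/le_primeP => p [pM pJ _ _];
  by rewrite !(nM, nn, pM, pJ); bool_cases p.
have II : is_ideal I.
  split=> [|a b [i [e [wi Ee aie]]] [j [f [wj Ef bjf]]]|a b ab [i [e [wi Ee bie]]]].
  - by exists bot, top; split=> //; [rewrite wb | case: EF].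
  - exists (join i j), (meet e f); split; [by rewrite wJ negb_or wi | exact: EM |].
    apply/le_primeP => p pP; move: (prime_le pP aie) (prime_le pP bjf).
    by case: pP => pM pJ _ _; rewrite !(nM, pM, pJ); bool_cases p.
  - by exists i, e; split=> //; exact: le_trans bie.
have [a Ea [i [e [wi Ee aie]]]|c [cP Ec Ic _]] := @prime_filter_maximal E I EF II.
  (* A common element [a] of [E] and [I] gives [¬(x ∨ i) ≤ x ∨ i]. With [z] in [w] disjoint from
     [i], the quasi-identity then forces [neg z = top], so [z = bot]. *)
  have [x xn xae] := EM _ _ Ea Ee; have [z wz iz0] := wmax i wi.
  suff : neg z = top by move=> z1; move: wz; rewrite -(nn z) z1 neg_top wb.
  apply: (fixA x i) => //; last by rewrite -nM iz0 neg_bot.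
  apply/le_primeP => p pP; have qP := dual_prime pP.
  move: (prime_le pP aie) (prime_le pP xae) (prime_le qP xae).
  case: pP => pM pJ _ _; rewrite /dual !(nM, neg_join, nn, pM, pJ).
  bool_cases p.
have [cM cJ _ _] := cP; exists c; split=> //.
- apply: funext => a; move: (Ec _ (Eex a)); rewrite /dual cJ.
  have : ~~ c (meet a (neg a)).
    apply: Ic; exists bot, (join a (neg a)); split; rewrite ?wb //.
    by rewrite neg_join nn mC.
  by rewrite cM; bool_cases c.
- move=> a; apply: contraLR => wa; apply: Ic.
  by exists a, top; split=> //; case: EF.
Qed.

End DeMorgan.

(** * The four-element algebra that generates De Morgan algebras *)

Definition four : algebra := {|
  carrier := bool * bool;
  meet a b := (a.1 && b.1, a.2 && b.2);
  join a b := (a.1 || b.1, a.2 || b.2);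
  neg a := (~~ a.2, ~~ a.1);
  bot := (false, false);
  top := (true, true) |}.

Lemma four_de_morgan : de_morgan four.
Proof. by do ![split]; do ![case=> -[] []]. Qed.

Lemma prime_four_hom (A : algebra) (p : A -> bool) : de_morgan A -> is_prime p ->
  is_hom (fun a => (p a, dual p a) : four).
Proof.
move=> dmA pP; have := dual_prime dmA pP.
case: pP => pM pJ pb pt [qM qJ qb qt]; split=> [a b|a b|a||] /=.
- by rewrite pM qM.
- by rewrite pJ qJ.
- by rewrite dual_neg // /dual negbK.
- by rewrite pb qb.
- by rewrite pt qt.
Qed.

(** Primes separate points, and each pair [(p, dual p)] is a homomorphism into [four]. *)
Lemma valid_fourP s t :
  (forall v : nat -> four, eval v s = eval v t) -> valid de_morgan s t.
Proof.
move=> H A dmA v; apply/(eq_primeP dmA) => p pP.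
have := H (fun n => (p (v n), dual p (v n))).
by rewrite -!(eval_hom v _ (prime_four_hom dmA pP)) => -[].
Qed.

(** * Mapping an algebra into the free algebra *)

Local Notation F := (free_algebra de_morgan).
Local Notation class := (term_class de_morgan).

Lemma free_de_morgan : de_morgan F.
Proof. exact: free_algebra_in de_morgan_quasivariety. Qed.

Lemma class_meet s t : class (s ⊓ t) = meet (class s : F) (class t).
Proof. by case: (term_class_hom de_morgan) => ->. Qed.

Lemma class_join s t : class (s ⊔ t) = join (class s : F) (class t).
Proof. by case: (term_class_hom de_morgan) => _ ->. Qed.

Lemma class_neg s : class (¬ s) = neg (class s : F).
Proof. by case: (term_class_hom de_morgan) => _ _ ->. Qed.

(* The element of the free algebra on two generators given by the upset of points
   of its dual space that are sent to a prime containing a fixed element of A;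
   l, c, p, q, u tell which of [dual w], c, p, [dual p], w contain it. *)
Definition code (l c p q u : bool) : term :=
  let x := Var 0 in let y := Var 1 in
  let s := x ⊓ ¬ x in let t := y ⊓ ¬ y in
  let s' := x ⊔ ¬ x in let t' := y ⊔ ¬ y in
  if l then ⊤ else if ~~ u then ⊥ else
  (s ⊓ t') ⊔ (t ⊓ s') ⊔ (if c then s' ⊓ t' else ⊥)
  ⊔ (if p then s else ⊥) ⊔ (if q then t else ⊥).

(** These are the inclusions of [dual w] in [c], [p], [dual p], and of those three in [w]. *)
Definition code_dom (l c p q u : bool) : bool :=
  [&& l ==> c, l ==> p, l ==> q, c ==> u, p ==> u & q ==> u].

(* [i] says to which of the five primes the point [v] of the dual space is sent. *)
Lemma eval_code (v : nat -> four) : exists i, forall l c p q u,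
  code_dom l c p q u -> eval v (code l c p q u) =
  nth (l, u) [:: (c, c); (p, q); (q, p); (u, l)] i :> four.
Proof.
case v0E: (v 0) => [[] []]; case v1E: (v 1) => [[] []];
by [exists 0; do 5!case; rewrite //= v0E v1E|exists 1; do 5!case; rewrite //= v0E v1E
   |exists 2; do 5!case; rewrite //= v0E v1E|exists 3; do 5!case; rewrite //= v0E v1E
   |exists 4; do 5!case; rewrite //= v0E v1E].
Qed.

(** At a given [v] one index reads off the values of all codes, so only the five pairs need checking
    in [four]. Join and negation go the same way. *)
Lemma code_meet l c p q u l' c' p' q' u' :
    code_dom l c p q u -> code_dom l' c' p' q' u' ->
    code_dom (l && l') (c && c') (p && p') (q && q') (u && u') ->
  valid de_morgan (code (l && l') (c && c') (p && p') (q && q') (u && u'))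
    (code l c p q u ⊓ code l' c' p' q' u').
Proof.
move=> d d' dd'; apply: valid_fourP => v; have [i E] := eval_code v.
(* Indices past the list give the default [(l, u)], the fifth point, sent to [dual w]. *)
by rewrite /= !E //; case: i E => [|[|[|[|i]]]] //= _; rewrite !nth_nil.
Qed.

Lemma code_join l c p q u l' c' p' q' u' :
    code_dom l c p q u -> code_dom l' c' p' q' u' ->
    code_dom (l || l') (c || c') (p || p') (q || q') (u || u') ->
  valid de_morgan (code (l || l') (c || c') (p || p') (q || q') (u || u'))
    (code l c p q u ⊔ code l' c' p' q' u').
Proof.
move=> d d' dd'; apply: valid_fourP => v; have [i E] := eval_code v.
by rewrite /= !E //; case: i E => [|[|[|[|i]]]] //= _; rewrite !nth_nil.
Qed.

Lemma code_neg l c p q u :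
    code_dom l c p q u -> code_dom (~~ u) (~~ c) (~~ q) (~~ p) (~~ l) ->
  valid de_morgan (code (~~ u) (~~ c) (~~ q) (~~ p) (~~ l)) (¬ code l c p q u).
Proof.
move=> d d'; apply: valid_fourP => v; have [i E] := eval_code v.
by rewrite /= !E //; case: i E => [|[|[|[|i]]]] //= _; rewrite !nth_nil.
Qed.

Lemma code_inj_p l c p q u l' c' p' q' u' :
  code_dom l c p q u -> code_dom l' c' p' q' u' ->
  valid de_morgan (code l c p q u) (code l' c' p' q' u') -> p = p'.
Proof.
(* This is the point sent to [p]: both variables take negation fixed points of [four]. *)
pose v n : four := if n is 0 then (true, false) else (false, true).
have E l0 c0 p0 q0 u0 : code_dom l0 c0 p0 q0 u0 ->
    eval v (code l0 c0 p0 q0 u0) = (p0, q0).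
  by rewrite /code_dom; case: l0 c0 p0 q0 u0 => [] [] [] [] [].
by move=> d d' /(_ four four_de_morgan v); rewrite !E // => -[].
Qed.

Lemma separating_hom (A : algebra) (p : A -> bool) : de_morgan A ->
  weakly_connected A -> fixpoint_dense A -> is_prime p ->
  exists h : A -> F, is_hom h /\ forall a b, h a = h b -> p a = p b.
Proof.
move=> dmA conA fixA pP.
have [w [wP pw qw wmax]] := maximal_above_dual dmA conA pP.
have [c [cP cd cw]] := fixpoint_below_maximal dmA fixA wP wmax.
pose h a : F := class (code (dual w a) (c a) (p a) (dual p a) (w a)).
have dom a : code_dom (dual w a) (c a) (p a) (dual p a) (w a).
  (* Contraposing the inclusions in [w] at [neg a] yields those above [dual w] at [a]. *)
  move: (pw a) (qw a) (cw a) (pw (neg a)) (qw (neg a)) (cw (neg a)).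
  have ca : c a = ~~ c (neg a) by rewrite -{1}cd.
  rewrite dual_neg // => ? ? ? pwn qwn cwn.
  do ![apply/andP; split]; apply/implyP => //.
  - by rewrite ca; apply: contra.
  - exact: contraR.
  - exact: contra.
exists h; split; last by move=> a b /term_classP /code_inj_p; apply.
move: wP (dual_prime dmA wP) pP (dual_prime dmA pP) cP
  => [wM wJ wb wt] [lM lJ lb lt] [pM pJ pb pt] [qM qJ qb qt] [cM cJ cb ct].
rewrite /h; split=> [a b|a b|a||].
- rewrite -class_meet; apply/term_classP; have := dom (meet a b).
  by rewrite wM lM pM qM cM; apply: code_meet.
- rewrite -class_join; apply/term_classP; have := dom (join a b).
  by rewrite wJ lJ pJ qJ cJ; apply: code_join.
- rewrite -class_neg; apply/term_classP; have := dom (neg a).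
  have nd r : r (neg a) = ~~ dual r a by rewrite negbK.
  rewrite !dual_neg // (nd w) (nd p) (nd c) cd; apply: code_neg.
  exact: dom.
- by rewrite wb lb pb qb cb.
- by rewrite wt lt pt qt ct.
Qed.

(** * Validity of the quasi-identities in the free algebra *)

Lemma weakly_connectedP (A : algebra) :
  let x := Var 0 in let y := Var 1 in
  satisfies A ([:: x ≼ ¬ x; y ≼ ¬ y; x ⊓ y ≈ ⊥] ⇒ x ⊔ y ≼ ¬ (x ⊔ y)) <->
  weakly_connected A.
Proof.
move=> x y; split=> [sat a b aa bb ab|conA v prem].
  apply: (sat (nth a [:: a; b])) => e; rewrite !inE.
  by case/or3P => /eqP->.
by apply: conA; [apply: (prem (x ≼ ¬ x)) | apply: (prem (y ≼ ¬ y))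
  | apply: (prem (x ⊓ y ≈ ⊥))]; rewrite !inE eqxx ?orbT.
Qed.

Lemma fixpoint_denseP (A : algebra) :
  let x := Var 0 in let y := Var 1 in let z := Var 2 in
  satisfies A ([:: x ≼ ¬ x; ¬ (x ⊔ y) ≼ x ⊔ y; ¬ y ⊔ z ≈ ⊤] ⇒ z ≈ ⊤) <->
  fixpoint_dense A.
Proof.
move=> x y z; split=> [sat a b c aa ab bc|fixA v prem].
  apply: (sat (nth a [:: a; b; c])) => e; rewrite !inE.
  by case/or3P => /eqP->.
by apply: (fixA (v 0) (v 1)); [apply: (prem (x ≼ ¬ x)) | apply: (prem (¬ (x ⊔ y) ≼ x ⊔ y))
  | apply: (prem (¬ y ⊔ z ≈ ⊤))]; rewrite !inE eqxx ?orbT.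
Qed.

(* (false, true) is a fixed point of negation, so only 0, 1 and it occur as values. *)
Lemma eval_middle t (r := @eval four (fun=> (false, true)) t) :
  (r.1 -> valid de_morgan t ⊤) /\ (~~ r.2 -> valid de_morgan t ⊥).
Proof.
rewrite {}/r; elim: t => [n|s [s1 s0] t [t1 t0]|s [s1 s0] t [t1 t0]|t [t1 t0]||] //=.
- split=> [/andP[/s1 sT /t1 tT]|/nandP[/s0|/t0] E] A dmA v /=.
  + by rewrite sT // tT //; case: dmA => _ _ _ [].
  + by rewrite E // meet_bot.
  + by rewrite E //=; case: (dmA) => -[_ -> _ _ _ _ _]; rewrite meet_bot.
- split=> [/orP[/s1|/t1] E|/norP[/s0 sB /t0 tB]] A dmA v /=.
  + by rewrite E // join_top.
  + by rewrite E //=; case: (dmA) => -[_ _ _ [_ -> _ _ _ _]]; rewrite join_top.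
  + by rewrite sB // tB //; case: dmA => _ _ _ [].
- split=> [/t0|/negPn/t1] E A dmA v /=.
  + by rewrite E // neg_bot.
  + by rewrite E // neg_top.
Qed.

(** When all variables take the value [(false, true)], one joinand has first coordinate true, and
    [eval_middle] makes it [top]. *)
Lemma free_join_top (a b : F) : join a b = top -> a = top \/ b = top.
Proof.
rewrite -(class_reprK a) -(class_reprK b) -class_join.
move=> /term_classP/(_ four four_de_morgan (fun=> (false, true)))[/orP E _].
by case: E => /(proj1 (eval_middle _)) E; [left | right]; apply/term_classP.
Qed.

Lemma free_meet_bot (a b : F) : meet a b = bot -> a = bot \/ b = bot.
Proof.
rewrite -(class_reprK a) -(class_reprK b) -class_meet.
move=> /term_classP/(_ four four_de_morgan (fun=> (false, true)))[_ /negbT/nandP E].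
by case: E => /(proj2 (eval_middle _)) E; [left | right]; apply/term_classP.
Qed.

(** Sending all variables to [top] keeps values in the Boolean subalgebra [{bot, top}] of [four],
    where negation has no fixed point. *)
Lemma free_neg_neq (a : F) : neg a <> a.
Proof.
rewrite -(class_reprK a) -class_neg => /term_classP.
move: (class_repr a) => t /(_ four four_de_morgan (fun=> (true, true))).
suff [b /= ->] : exists b, @eval four (fun=> (true, true)) t = (b, b).
  by case: b.
elim: t => [n|s [b sb] t [c tc]|s [b sb] t [c tc]|t [b tb]||] /=.
- by exists true.
- by exists (b && c); rewrite sb tc.
- by exists (b || c); rewrite sb tc.
- by exists (~~ b); rewrite tb.
- by exists false.
- by exists true.
Qed.

Lemma free_weakly_connected : weakly_connected F.
Proof.
have dmF := free_de_morgan; have [_ [_ jC _] _ [jb _] _] := dmF.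
move=> a b aa bb /free_meet_bot[] ab; first by rewrite ab jb.
by rewrite ab jC jb.
Qed.

(** If [c] is not [top], join-primeness gives [b = bot], and then [a] would be a fixed point of
    negation. *)
Lemma free_fixpoint_dense : fixpoint_dense F.
Proof.
have dmF := free_de_morgan; have [[_ mC _] [_ jC _] _ [jb _] [nn _]] := dmF.
move=> a b c aa ab /free_join_top[] // nb.
have b0 : b = bot by rewrite -(nn b) nb neg_top.
move: ab; rewrite b0 jC jb /le mC => ab.
by case: (@free_neg_neq a); rewrite -ab.
Qed.

Theorem theorem27 :
  let x := Var 0 in let y := Var 1 in let z := Var 2 in
  admissible_basis de_morgan
    [set ([:: x ≼ ¬ x; ¬ (x ⊔ y) ≼ x ⊔ y; ¬ y ⊔ z ≈ ⊤] ⇒ z ≈ ⊤);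
         ([:: x ≼ ¬ x; y ≼ ¬ y; x ⊓ y ≈ ⊥] ⇒ x ⊔ y ≼ ¬ (x ⊔ y))].
Proof.
move=> x y z A; set L := [set _; _]; split=> [genA|[dmA LA] Q [M QM] FQ].
  apply: (genA (fun B => de_morgan B /\ satisfies_all B L)).
    have [K KP] := de_morgan_quasivariety; exists (K `|` L) => B.
    rewrite KP; split=> [[KB LB] q [/KB|/LB] //|KL].
    by split=> q Hq; apply: KL; [left | right].
  move=> _ ->; split; first exact: free_de_morgan.
  move=> q [|] ->.
    by apply/fixpoint_denseP; exact: free_fixpoint_dense.
  by apply/weakly_connectedP; exact: free_weakly_connected.
have fixA : fixpoint_dense A by apply/fixpoint_denseP; apply: LA; left.
have conA : weakly_connected A by apply/weakly_connectedP; apply: LA; right.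
(* The conclusion is checked one prime at a time; [h] carries the premises to [F], where [q]
   holds. *)
apply/QM => q Mq v prem; apply/(eq_primeP dmA) => p pP.
have [h [hom_h sep_h]] := separating_hom dmA conA fixA pP.
apply: sep_h; rewrite !(eval_hom _ _ hom_h).
apply: (iffLR (QM F) (FQ F erefl) q Mq) => e /prem; rewrite /holds -!(eval_hom _ _ hom_h).
by move=> ->.
Qed.
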